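(* Suppose $H=(V,E)$ is a sparse hypergraph on $n$ vertices. Then triangle and simplex enumeration can be performed in $O(n)$ rounds on $H$ in the EDGE BROADCAST (EB) and PRIMAL CONGEST (PC) models.
   Context: A hypergraph $H=(V,E)$ has vertex set $V$, $|V|=n$, and a set $E$ of nonempty subsets of $V$; its rank $r$ is the maximum cardinality of an edge. $H$ is sparse if $\sum_{e\in E}|e|=O(n)$ (i.e. at most $Cn$ for a constant $C$ independent of $n$). A triangle is a simple cycle of length three $(v_0,e_0,v_1,e_1,v_2,e_2)$: distinct vertices, distinct edges, $v_i\in e_{i-1}\cap e_i$ (indices mod $3$); it is induced if moreover $v_i\notin e_{i+1}$ for each $i$. An ($r$-dimensional) simplex is a set of $r+1$ vertices all of whose $r$-element subsets are edges. In the triangle (simplex) enumeration problem each vertex outputs a set of triangles (simplices) such that these sets are pairwise disjoint and their union is the set of all triangles (simplices) of $H$; the triangle result applies both to all triangles and to all induced triangles. Computation: vertices are nodes with unique $O(\log n)$-bit IDs; synchronous rounds with unbounded local computation; $B=\Theta(\log n)$; initially each vertex knows its ID and its incident edges, including the IDs of the vertices in them ($\mathrm{KT}_1$), with a port numbering. In EB, in each round, for each vertex $v$ and each edge $e\ni v$, $v$ can broadcast one $B$-bit message to all vertices of $e$ (possibly different messages on different edges). In PC, in each round each vertex $v$ can send a distinct $B$-bit message to each vertex sharing an edge with $v$ (one per such vertex).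
   Formalization: Simplex enumeration is stated for dimension r ≥ 2, with r a given parameter of the problem; for rank 1 the claim is false: with only the singleton edges {u} and {v}, no messages can be sent, so no vertex can output the simplex {u,v}. *)

(* Defs.v *)
From HB Require Import structures.
From mathcomp Require Import all_boot all_order all_algebra.
From mathcomp Require Import finmap.

Set Implicit Arguments.
Unset Strict Implicit.
Unset Printing Implicit Defensive.

Import GRing.Theory.

Record hypergraph (V : finType) := Hypergraph {
  edges : {set {set V}};
  edges_nonempty : set0 \notin edges
}.

Definition sparse (C : nat) (V : finType) (H : hypergraph V) : Prop :=
  \sum_(e in edges H) #|e| <= C * #|V|.

(* Bit-length of n, i.e. the ceiling of log2 (n + 1): this is Theta(log n), and
   it is positive at n = 1. *)
Definition lg (n : nat) : nat := up_log 2 n.+1.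

Definition theta_log (B : nat -> nat) : Prop :=
  exists c : nat, forall n, 0 < n -> lg n <= c * B n /\ B n <= c * lg n.

Section Problems.
Variable V : finType.
Implicit Types (H : hypergraph V) (S : {set V}).
Implicit Types (v : {ffun 'I_3 -> V}) (e : {ffun 'I_3 -> {set V}}).

(* Indices live in 'I_3, whose ring operations are modulo 3. *)
Definition triangle_seq H v e : bool :=
  [&& injectiveb v, injectiveb e, [forall i, e i \in edges H] &
      [forall i, v i \in e (i - 1)%R :&: e i]].

Definition induced_seq v e : bool := [forall i, v i \notin e (i + 1)%R].

(* The sequence (v0, e0, v1, e1, v2, e2) up to rotation and reversal: it is
   represented by its six vertex-edge incidences. *)
Definition incidences v e : {set V * {set V}} :=
  [set (v i, e i) | i : 'I_3] :|: [set (v i, e (i - 1)%R) | i : 'I_3].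

Definition triangles H : {set {set V * {set V}}} :=
  [set incidences t.1 t.2
     | t : {ffun 'I_3 -> V} * {ffun 'I_3 -> {set V}} & triangle_seq H t.1 t.2].

Definition induced_triangles H : {set {set V * {set V}}} :=
  [set incidences t.1 t.2
     | t : {ffun 'I_3 -> V} * {ffun 'I_3 -> {set V}}
     & triangle_seq H t.1 t.2 && induced_seq t.1 t.2].

(* The dimension r is a parameter; it may be the rank of H.  For r = 1 these are
   the pairs of vertices carrying singleton edges, which need not be connected,
   so only r >= 2 is meaningful for message passing. *)
Definition simplices (r : nat) H : {set {set V}} :=
  [set S : {set V} | (#|S| == r.+1) &&
     [forall F : {set V}, (F \subset S) && (#|F| == r) ==> (F \in edges H)]].

Definition name_set (id : V -> nat) S : {fset nat} := [fset id v | v in S]%fset.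

Definition name_triangle (id : V -> nat) (T : {set V * {set V}}) :
    {fset nat * {fset nat}} :=
  [fset (id p.1, name_set id p.2) | p in T]%fset.

End Problems.

(* A vertex can only write down objects in terms of identifiers; [name] is the
   resulting (injective, for injective [id]) rendering of an object. *)
Record problem := Problem {
  object : finType -> finType;
  named : choiceType;
  name : forall V : finType, (V -> nat) -> object V -> named;
  solutions : forall V : finType, hypergraph V -> {set object V}
}.

Definition triangle_problem : problem :=
  @Problem (fun V => {set V * {set V}} : finType) _ name_triangle triangles.

Definition induced_triangle_problem : problem :=
  @Problem (fun V => {set V * {set V}} : finType) _ name_triangle
           induced_triangles.

Definition simplex_problem (r : nat) : problem :=
  @Problem (fun V => {set V} : finType) _ name_set (@simplices^~ r).

(* Unique identifiers of O(log n) bits (at most [a * lg n]), and an arbitrary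
   numbering [ports v] of the edges incident to each vertex v. *)
Record network (V : finType) (H : hypergraph V) (a : nat) := Network {
  ident : V -> nat;
  ident_inj : injective ident;
  ident_bits : forall v, ident v < 2 ^ (a * lg #|V|);
  ports : V -> seq {set V};
  ports_uniq : forall v, uniq (ports v);
  ports_incident : forall v e, (e \in ports v) = (e \in edges H) && (v \in e)
}.

(* A vertex chooses one optional message per element of [addr], and receives one
   optional message per element of [src]. *)
Record model := Model {
  addr : Type;
  src : Type;
  deliver : forall (V : finType) (H : hypergraph V) (a : nat)
    (N : network H a) (Msg : Type),
    (V -> addr -> option Msg) -> V -> src -> option Msg
}.

(* Outgoing messages are indexed by a port, incoming ones by a port of the
   receiver and the identifier of the sender. *)
Definition EB_deliver (V : finType) (H : hypergraph V) (a : nat)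
    (N : network H a) (Msg : Type) (out : V -> nat -> option Msg)
    (v : V) (s : nat * nat) : option Msg :=
  let e := nth set0 (ports N v) s.1 in
  if [pick u in e | ident N u == s.2] is Some u
  then out u (index e (ports N u)) else None.

Definition EB : model := Model EB_deliver.

Definition adjacent (V : finType) (H : hypergraph V) (u v : V) : bool :=
  (u != v) && [exists e in edges H, (u \in e) && (v \in e)].

(* Outgoing messages are indexed by the identifier of the receiver, incoming
   ones by the identifier of the sender. *)
Definition PC_deliver (V : finType) (H : hypergraph V) (a : nat)
    (N : network H a) (Msg : Type) (out : V -> nat -> option Msg)
    (v : V) (x : nat) : option Msg :=
  if [pick u | adjacent H u v && (ident N u == x)] is Some u
  then out u (ident N v) else None.

Definition PC : model := Model PC_deliver.

(* Messages have b bits. The initial state depends on the identifier of the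
   vertex and on the identifiers of the members of its incident edges, listed by
   port; in particular a vertex is not told n. *)
Record algorithm (M : model) (b : nat) (Out : Type) := Algorithm {
  state : Type;
  init : nat -> seq {fset nat} -> state;
  send : state -> addr M -> option (b.-tuple bool);
  recv : state -> (src M -> option (b.-tuple bool)) -> state;
  output : state -> option Out
}.

Section Execution.
Variables (M : model) (b : nat) (Out : Type) (A : algorithm M b Out).
Variables (V : finType) (H : hypergraph V) (a : nat) (N : network H a).

Definition start (v : V) : state A :=
  init A (ident N v) [seq name_set (ident N) e | e <- ports N v].

(* A vertex that has produced its output has halted: it sends nothing and its
   state, hence its output, is final. *)
Definition outbox (st : V -> state A) (u : V) (x : addr M) :=
  if output (st u) is Some _ then None else send (st u) x.

Definition next (st : V -> state A) (v : V) : state A :=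
  if output (st v) is Some _ then st v
  else recv (st v) (deliver N (outbox st) v).

Definition run (t : nat) : V -> state A := iter t next start.

End Execution.

Definition enumerates (M : model) (b : nat) (P : problem)
    (A : algorithm M b {fset named P}) (V : finType) (H : hypergraph V)
    (a : nat) (N : network H a) (T : nat) : Prop :=
  exists X : V -> {set object P V},
    [/\ forall v, output (run A N T v) = Some [fset name (ident N) x | x in X v]%fset,
        forall u v, u != v -> [disjoint X u & X v] &
        \bigcup_v X v = solutions P H].

Definition sparse_enumerable (M : model) (P : problem)
    (B : nat -> nat) (a C K : nat) : Prop :=
  exists A : forall b, algorithm M b {fset named P},
    forall (V : finType) (H : hypergraph V) (N : network H a),
      sparse C H -> enumerates (A (B #|V|)) N (K * #|V|).

(* Main.v *)
(* Every vertex broadcasts, one per phase and each only once, the tokens that it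
   knows: its own identifier and, for every edge of which it is the member of least
   identifier, one token per member of the edge. A sparse hypergraph has O(n)
   tokens, of O(log n) bits each, so a phase takes O(1) rounds.

   A token is only delayed by other tokens (Topkis): if a token originates at
   distance d from v, then after t phases v has sent it or has sent at least t - d
   tokens. This also lets a vertex that ignores n detect termination. If it knows s
   tokens and t > 2 s, then it has sent all tokens from distance at most s; every
   vertex emits a token of its own, so there is no vertex of its component at a
   distance larger than s. Hence it knows its whole component, and it can halt since
   it has nothing left to send. With k tokens this happens by phase 2 k + 1. The
   vertex then outputs the triangles or simplices in which its identifier is least. *)

Require Import Defs.
From mathcomp Require Import all_boot all_algebra finmap.
From mathcomp Require Import zify.
From Stdlib Require Import FunctionalExtensionality ClassicalEpsilon.
Set Implicit Arguments.
Unset Strict Implicit.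
Unset Printing Implicit Defensive.

(** * Gossip *)

Section Gossip.
Variables (V Y : finType) (e : rel V) (tokens : V -> {set Y}).

(** A gossip state is a pair of token sets: those known and those already sent. Any rule that picks
    a known but unsent token would serve. *)
Definition fresh (g : {set Y} * {set Y}) : option Y := [pick y in g.1 :\: g.2].

Fixpoint gossip (t : nat) : V -> {set Y} * {set Y} :=
  if t is t'.+1 then fun v =>
    ((gossip t' v).1 :|:
       [set y | [exists u, e v u && (fresh (gossip t' u) == Some y)]],
     (gossip t' v).2 :|: [set y | fresh (gossip t' v) == Some y])
  else fun v => (tokens v, set0).

Local Notation known t v := (gossip t v).1.
Local Notation sent t v := (gossip t v).2.

Lemma fresh_None g : (fresh g == None) = (g.1 \subset g.2).
Proof.
rewrite /fresh; case: pickP => [y|] gP; last first.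
  rewrite eqxx; apply/esym/subsetP => y yg; move: (gP y).
  by rewrite !inE yg andbT => /negbFE.
by apply/esym/negP => /subsetP/(_ y); move: gP; rewrite !inE => /andP[/negP gy ->] /(_ isT).
Qed.

Lemma fresh_Some g y : fresh g = Some y -> (y \in g.1) && (y \notin g.2).
Proof. by rewrite /fresh; case: pickP => // z + [<-]; rewrite !inE andbC. Qed.

Lemma known_tokens t v : tokens v \subset known t v.
Proof. by elim: t => //= t IH; apply: subset_trans IH (subsetUl _ _). Qed.

Lemma sent_known t v : sent t v \subset known t v.
Proof.
elim: t v => [|t IH] v /=; first exact: sub0set.
rewrite subUset; apply/andP; split; first exact: subset_trans (IH v) (subsetUl _ _).
apply/subsetP => y; rewrite !inE => /eqP/fresh_Some/andP[-> _]; exact: orTb.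
Qed.

(** Reception is immediate: a token enters the sent set of [u] in the same step in which [v] learns
    it. *)
Lemma heard_known t v u : e v u -> sent t u \subset known t v.
Proof.
move=> evu; elim: t => [|t IH] /=; first exact: sub0set.
rewrite subUset; apply/andP; split; first exact: subset_trans IH (subsetUl _ _).
apply/subsetP => y; rewrite !inE => fy; apply/orP; right.
by apply/existsP; exists u; rewrite evu.
Qed.

Lemma card_sentS t v :
  #|sent t.+1 v| = #|sent t v| + (fresh (gossip t v) : bool).
Proof.
case Ef: (fresh (gossip t v)) => [y|] /=; rewrite Ef; last first.
  by rewrite addn0; apply: eq_card => y; rewrite !inE orbF.
case/andP: (fresh_Some Ef) => _ yN; rewrite addnC.
have := cardsU1 y (sent t v); rewrite yN => <-.
by apply: eq_card => z; rewrite !inE orbC eq_sym.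
Qed.

(* A vertex that is idle in round t has already sent whatever the next vertex of
   the path sent before that round, so it has lost at most one more round. *)
Lemma sent_or_busy t v p y : path e v p -> y \in tokens (last v p) ->
  (y \in sent t v) || (t <= size p + #|sent t v|).
Proof.
elim: p v t => [|w p IHp] v t pv yp; elim: t => [|t IH]; rewrite ?orbT //;
  (* A busy round adds one to both sides of the bound; only idle rounds remain after this. *)
  rewrite card_sentS; (case Ef: (fresh (gossip t v)) => [z|];
    first by case/orP: IH => [yv|le_t]; apply/orP; [left|right];
      [rewrite inE yv | rewrite /= addn1 addnS]);
  move/eqP: Ef; rewrite fresh_None => sub.
  by rewrite inE (subsetP sub) // (subsetP (known_tokens t v)).
case/andP: pv => evw pw; have subw := subset_trans (heard_known t evw) sub.
case/orP: (IHp w t pw yp) => [/(subsetP subw) yv|le_t]; first by rewrite inE yv.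
by apply/orP; right; rewrite addn0; have := subset_leq_card subw; move: le_t => /=; lia.
Qed.

Lemma known_component t v :
  known t v \subset \bigcup_(u | connect e v u) tokens u.
Proof.
elim: t v => [|t IH] v /=; first exact: bigcup_sup (connect0 e v).
rewrite subUset IH; apply/subsetP => y; rewrite !inE.
case/existsP => u /andP[evu /eqP/fresh_Some/andP[/(subsetP (IH u))]].
case/bigcupP => w cuw yw _; apply/bigcupP; exists w => //.
exact: connect_trans (connect1 evu) cuw.
Qed.

(** The factor 2 comes from [sent_or_busy]: with [s] known tokens, an unsent token at distance at
    most [s] would force [t <= s + s]. The test uses only what [v] knows and the time. *)
Definition saturated t v := 2 * #|known t v| < t.

Variable token0 : V -> Y.
Hypothesis token0_inj : injective token0.
Hypothesis token0_in : forall v, token0 v \in tokens v.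

(* With s known tokens, every vertex of the component is at distance at most s:
   otherwise the first s.+1 vertices of a shortest path would already account for
   s.+1 known tokens. *)
Lemma saturated_sent t v : saturated t v ->
  \bigcup_(u | connect e v u) tokens u \subset sent t v.
Proof.
rewrite /saturated => sat.
have le_sk := subset_leq_card (sent_known t v).
have near p y : path e v p -> size p <= #|known t v| ->
    y \in tokens (last v p) -> y \in sent t v.
  by move=> pv ps /(sent_or_busy t pv)/orP[] //; lia.
apply/bigcupsP => u /connectP[p0 /shortenP[p pv up _] ->{u}].
apply/subsetP => y yu; case: (leqP (size p) #|known t v|) => [ps|ps]; first exact: near yu.
set s := #|known t v|.
suff: s < #|known t v| by rewrite ltnn.
(* The vertex [v] and the first [s] vertices after it are distinct and within distance [s], so their
   own tokens have all been sent. *)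
have <-: size (map token0 (v :: take s p)) = s.+1.
  by rewrite size_map /= size_takel // ltnW.
rewrite cardE; apply: uniq_leq_size.
  rewrite map_inj_uniq //; move: up; rewrite -{1}(cat_take_drop s p) -cat_cons.
  by rewrite cat_uniq => /andP[].
move=> _ /mapP[w w_p ->]; rewrite mem_enum.
apply: (subsetP (sent_known t v)).
have : path e v (take s p) by apply: take_path.
have : size (take s p) <= s by rewrite size_takel // ltnW.
case/splitPl: (take s p) / w_p => p1 p2 <-; rewrite size_cat cat_path => p_le /andP[pv1 _].
apply: near pv1 _ (token0_in _); exact: leq_trans (leq_addr _ _) p_le.
Qed.

Lemma saturated_known t v : saturated t v ->
  known t v = \bigcup_(u | connect e v u) tokens u.
Proof.
move=> sat; apply/eqP; rewrite eqEsubset known_component /=.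
exact: subset_trans (saturated_sent sat) (sent_known t v).
Qed.

(** This makes halting harmless to the others: a saturated vertex would be silent anyway. *)
Lemma saturated_fresh t v : saturated t v -> fresh (gossip t v) = None.
Proof.
move=> sat; apply/eqP; rewrite fresh_None saturated_known //; exact: saturated_sent.
Qed.

(** Freezing the state of a halted vertex thus agrees with the gossip process, which itself never
    halts. *)
Lemma saturated_next t v : saturated t v -> gossip t.+1 v = gossip t v.
Proof.
move=> sat; have f0 := saturated_fresh sat.
have k1 : known t.+1 v = known t v.
  apply/eqP; rewrite eqEsubset [X in _ && X]subsetUl andbT (saturated_known sat).
  exact: known_component.
rewrite [LHS]surjective_pairing [RHS]surjective_pairing k1; congr pair => /=.
by rewrite f0; apply/setUidPl/subsetP => y; rewrite inE.
Qed.

Lemma saturatedS t v : saturated t v -> saturated t.+1 v.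
Proof. by move=> sat; rewrite /saturated saturated_next //; apply: leqW. Qed.

Lemma saturated_late t v : 2 * #|\bigcup_u tokens u| < t -> saturated t v.
Proof.
apply: leq_ltn_trans; rewrite leq_mul2l /=; apply: subset_leq_card.
apply: subset_trans (known_component t v) _; apply/bigcupsP => u _.
exact: bigcup_sup.
Qed.
End Gossip.

(** * Splitting messages over several rounds *)

Section Chunking.
Variables (M : model) (b q : nat) (Out : Type) (Y : finType) (St : Type).
Variables (first : nat -> seq {fset nat} -> St) (message : St -> option Y).
Variables (update : St -> (src M -> option Y) -> St) (answer : St -> option Out).

(** A block code of [q.+1] words of [b] bits, matching elements of equal rank. The default of [nth]
    is out of reach once [Y] fits, as in [codeword_inj]. *)
Definition codeword (y : Y) : {ffun 'I_q.+1 -> b.-tuple bool} :=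
  nth [ffun=> nseq_tuple b false]
      (enum {: {ffun 'I_q.+1 -> b.-tuple bool}}) (enum_rank y).

Lemma codeword_inj : #|Y| <= 2 ^ (b * q.+1) -> injective codeword.
Proof.
move=> leY y z; rewrite /codeword => /eqP.
have sz : size (enum {: {ffun 'I_q.+1 -> b.-tuple bool}}) = 2 ^ (b * q.+1).
  by rewrite -cardE card_ffun card_tuple card_bool card_ord expnM.
rewrite nth_uniq ?enum_uniq ?sz ?(leq_trans (ltn_ord _)) //.
by move/eqP/val_inj/enum_rank_inj.
Qed.

(** The buffer holds the inboxes of one phase, one per round. A source that stayed silent matches no
    codeword and decodes to [None]. *)
Definition decode (buf : seq (src M -> option (b.-tuple bool))) (s : src M) :
    option Y :=
  [pick y | [forall j : 'I_q.+1,
     nth (fun=> None) buf j s == Some (codeword y j)]].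

(* Each message of the coarse protocol is spread over q.+1 rounds. *)
Definition chunked : algorithm M b Out :=
  @Algorithm M b Out (St * seq (src M -> option (b.-tuple bool)))%type
    (fun i L => (first i L, [::]))
    (fun st _ => omap (fun y => codeword y (inord (size st.2))) (message st.1))
    (fun st inbox => if size st.2 == q
                     then (update st.1 (decode (rcons st.2 inbox)), [::])
                     else (st.1, rcons st.2 inbox))
    (fun st => answer st.1).

Hypothesis leY : #|Y| <= 2 ^ (b * q.+1).
Variables (V : finType) (H : hypergraph V) (a : nat) (N : network H a).
(** The abstraction of the model: when every vertex sends one common message to all its addresses,
    source [s] of [v] yields the message of a fixed vertex, if any. *)
Variable heard : V -> src M -> option V.
Hypothesis deliverE : forall (Msg : Type) (o : V -> addr M -> option Msg) m,
  (forall u x, o u x = m u) -> forall v s, deliver N o v s = obind m (heard v s).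

Definition emitted (st : V -> St) u :=
  if answer (st u) is Some _ then None else message (st u).

Definition coarse_next (st : V -> St) v :=
  if answer (st v) is Some _ then st v
  else update (st v) (fun s => obind (emitted st) (heard v s)).

Definition coarse_run t : V -> St :=
  iter t coarse_next
    (fun v => first (ident N v) [seq name_set (ident N) e | e <- ports N v]).

Let part (st : V -> St) k u := omap (codeword^~ (inord k)) (emitted st u).
Let chunk (st : V -> St) v k s := obind (part st k) (heard v s).

Lemma decode_chunks st v :
  decode (mkseq (chunk st v) q.+1) = fun s => obind (emitted st) (heard v s).
Proof.
apply: functional_extensionality => s; rewrite /decode.
have E y : [forall j : 'I_q.+1, nth (fun=> None) (mkseq (chunk st v) q.+1) j s
      == Some (codeword y j)] = (obind (emitted st) (heard v s) == Some y).
  apply/forallP/eqP => [all_j|Ey j]; last first.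
    rewrite nth_mkseq // /chunk /part; case: (heard v s) Ey => //= u ->.
    by rewrite /= inord_val.
  have get j := eqP (all_j j).
  have {}get (j : 'I_q.+1) : chunk st v j s = Some (codeword y j) by rewrite -get nth_mkseq.
  (* A phase has at least one round, so silence is already refuted by chunk 0. *)
  move: get; rewrite /chunk /part; case: (heard v s) => [u|] /= get; last by have:= get ord0.
  case Eu: (emitted st u) get => [z|] /= get; last by have:= get ord0.
  congr Some; apply: (codeword_inj leY); apply/ffunP => j.
  by have [] := get j; rewrite inord_val.
case: pickP => [y|none]; first by rewrite E => /eqP.
by case Eo: (obind _ _) => [y|//]; have:= none y; rewrite E Eo eqxx.
Qed.

(** Within a phase the coarse state, hence the answer, is constant, and the buffer length is the
    index of the next chunk. The last round, which empties the buffer, is left to [run_chunked]. *)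
Lemma chunk_phase (st0 : V -> state chunked) (st : V -> St) :
  (forall v, st0 v = (st v, [::])) -> forall j, j <= q -> forall v,
  iter j (Defs.next N) st0 v =
    (st v, if answer (st v) is Some _ then [::] else mkseq (chunk st v) j).
Proof.
move=> st0E; elim=> [|j IH] lt_jq v; first by rewrite /= st0E; case: (answer (st v)).
have {}IH := IH (ltnW lt_jq).
rewrite iterS /Defs.next IH /=.
case Ea: (answer (st v)) => [//|]; rewrite /= size_mkseq ltn_eqF //.
congr pair; rewrite mkseqS; congr rcons.
apply: functional_extensionality => s; apply: (@deliverE _ _ (part _ _)) => u x.
rewrite /outbox IH /= /part /emitted.
by case Eu: (answer (st u)) => [//|] /=; rewrite size_mkseq.
Qed.

Lemma run_chunked t v : run chunked N (t * q.+1) v = (coarse_run t v, [::]).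
Proof.
rewrite /run; elim: t v => [//|t IH] v.
rewrite mulSn iterD; set st0 := iter (t * _) _ _; rewrite iterS.
have ph := @chunk_phase st0 (coarse_run t) IH q (leqnn q).
rewrite {1}/Defs.next ph /= /coarse_next -/(coarse_run t).
case Ea: (answer (coarse_run t v)) => [//|]; rewrite /= size_mkseq eqxx.
congr pair; congr update; rewrite -decode_chunks; congr decode.
rewrite mkseqS; congr rcons.
apply: functional_extensionality => s; apply: (@deliverE _ _ (part _ _)) => u x.
rewrite /outbox ph //= /part /emitted.
by case Eu: (answer (coarse_run t u)) => [//|] /=; rewrite size_mkseq.
Qed.
End Chunking.

(** Passes from sources to senders, the form in which [gossip] describes reception. *)
Lemma has_obind (S : Type) (V : finType) (Y : eqType) (h : S -> option V)
    (m : V -> option Y) (l : seq S) y :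
  has (fun s => obind m (h s) == Some y) l =
  [exists u, has (fun s => h s == Some u) l && (m u == Some y)].
Proof.
elim: l => [|s l IH] /=; first by apply/esym/existsP => -[].
rewrite IH; apply/orP/existsP => [[]|[u /andP[/orP[/eqP->|hu] mu]]]; last 2 first.
- by left.
- by right; apply/existsP; exists u; rewrite hu.
- by case: (h s) => // u mu; exists u; rewrite eqxx.
- by case/existsP => u /andP[hu mu]; exists u; rewrite hu orbT.
Qed.

(** * Gossip with local termination *)

Section Protocol.
Variables (M : model) (Y : finType) (Out : Type).
Variable initial_tokens : nat -> seq {fset nat} -> {set Y}.
Variable listen : nat -> seq {fset nat} -> seq (src M).
Variable result : nat -> {set Y} -> Out.

Record gossip_state := GossipState {
  self : nat;
  sources : seq (src M);
  store : {set Y} * {set Y};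
  clock : nat
}.

Definition gossip_init i L :=
  GossipState i (listen i L) (initial_tokens i L, set0) 0.

Definition gossip_message st := fresh (store st).

Definition gossip_update st (inbox : src M -> option Y) :=
  GossipState (self st) (sources st)
    ((store st).1 :|: [set y | has (fun s => inbox s == Some y) (sources st)],
     (store st).2 :|: [set y | fresh (store st) == Some y])
    (clock st).+1.

Definition gossip_answer st :=
  if 2 * #|(store st).1| < clock st then Some (result (self st) (store st).1)
  else None.

Variables (V : finType) (H : hypergraph V) (a : nat) (N : network H a).
Variable heard : V -> src M -> option V.

Definition local_view v := [seq name_set (ident N) e | e <- ports N v].
Definition hears v u :=
  has (fun s => heard v s == Some u) (listen (ident N v) (local_view v)).
Definition tokens_of v := initial_tokens (ident N v) (local_view v).

Local Notation coarse :=
  (coarse_run gossip_init gossip_message gossip_update gossip_answer N heard).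

Variable token0 : V -> Y.
Hypothesis token0_inj : injective token0.
Hypothesis token0_in : forall v, token0 v \in tokens_of v.

(** The clock of a halted vertex stops, so the invariant records saturation in its place. Saturation
    persists and fixes the store, which therefore follows [gossip] at every [t]. *)
Lemma coarse_gossip t v :
  [/\ self (coarse t v) = ident N v,
      sources (coarse t v) = listen (ident N v) (local_view v),
      store (coarse t v) = gossip hears tokens_of t v &
      if gossip_answer (coarse t v) is Some _ then saturated hears tokens_of t v
      else clock (coarse t v) = t].
Proof.
elim: t v => [|t IH] v; first by split=> //; rewrite /gossip_answer ltn0.
rewrite /coarse_run iterS -/(coarse_run _ _ _ _ _ _ t) /coarse_next.
have [selfE srcE storeE] := IH v.
case Ea: (gossip_answer (coarse t v)) => [r|] sat.
  by rewrite (saturated_next token0_inj token0_in) //; split=> //; rewrite Ea; apply: (saturatedS token0_inj token0_in).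
have storeE' : store (gossip_update (coarse t v)
    (fun s => obind (emitted gossip_message gossip_answer (coarse t)) (heard v s)))
    = gossip hears tokens_of t.+1 v.
  rewrite /= storeE srcE; congr (_ :|: _, _); apply/setP => y; rewrite !inE.
  (* A halted sender emits nothing, and being saturated it has no fresh token either. *)
  have emE : emitted gossip_message gossip_answer (coarse t)
      =1 fun u => fresh (gossip hears tokens_of t u).
    move=> u; rewrite /emitted /gossip_message; have [_ _ -> ] := IH u.
    by case: (gossip_answer _) => // r sat_u; rewrite (saturated_fresh token0_inj token0_in).
  rewrite has_obind; apply: eq_existsb => u.
  by rewrite emE.
split=> //; rewrite /gossip_answer storeE' /saturated /= sat.
by case: ifP.
Qed.

Lemma coarse_answer t v : 2 * #|\bigcup_u tokens_of u| < t ->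
  gossip_answer (coarse t v) =
    Some (result (ident N v) (\bigcup_(u | connect hears v u) tokens_of u)).
Proof.
move=> late; have sat := saturated_late hears v late.
have [selfE _ storeE] := coarse_gossip t v.
rewrite -(saturated_known token0_inj token0_in sat).
case Ea: (gossip_answer (coarse t v)) => [r|] => [_|clockE]; last first.
  by move: Ea; rewrite /gossip_answer storeE clockE ifT.
by move: Ea; rewrite /gossip_answer selfE storeE; case: ifP => // _ [<-].
Qed.
End Protocol.

(** * Tokens describing a hypergraph *)

Section Names.
Variables (V : finType) (id : V -> nat).
Implicit Types (S G : {set V}) (w : V).

Lemma mem_name_set S x :
  reflect (exists2 w, w \in S & x = id w) (x \in name_set id S).
Proof. exact: imfsetP. Qed.

Lemma name_set_preim S (F : {fset nat}) : (F `<=` name_set id S)%fset ->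
  exists2 G : {set V}, G \subset S & F = name_set id G.
Proof.
move/fsubsetP => FS; exists [set w in S | id w \in F].
  by apply/subsetP => w; rewrite inE => /andP[].
apply/fsetP => x; apply/idP/mem_name_set => [xF|[w]].
  by case/mem_name_set: (FS _ xF) => w wS xw; exists w => //; rewrite inE wS -xw.
by rewrite inE => /andP[_ wF] ->.
Qed.

Hypothesis id_inj : injective id.

Lemma mem_name_inj S w : (id w \in name_set id S) = (w \in S).
Proof.
apply/mem_name_set/idP => [[u uS /id_inj ->] //|wS]; by exists w.
Qed.

Lemma card_name_set S : #|` name_set id S| = #|S|.
Proof. by rewrite card_imfset //= -cardE. Qed.

Lemma name_set_inj : injective (name_set id).
Proof. by move=> S G eSG; apply/setP => w; rewrite -!mem_name_inj eSG. Qed.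
End Names.

(* (i, 0, i) announces the vertex i; (i, j.+1, x) says that x is the identifier
   of a member of the edge on port j of i. The latter is only announced by the
   member i of least identifier, so that there is one token per incidence. *)
Definition token (n : nat) := ('I_n.+1 * 'I_n.+1 * 'I_n.+1)%type.

Definition own_tokens (n i : nat) (L : seq {fset nat}) : {set token n} :=
  [set y : token n | (y.1.1 == i :> nat) &&
     if y.1.2 : nat is j.+1 then
       ((y.2 : nat) \in nth fset0 L j) && all (leq i) (enum_fset (nth fset0 L j))
     else y.2 == i :> nat].

(** Tokens of one edge share their first two coordinates, announcer and port; gathering the third
    ones rebuilds the name of the edge. *)
Definition cluster n (K : {set token n}) (y : token n) : {fset nat} :=
  [fset nat_of_ord z.2 | z in [set z in K | z.1 == y.1]]%fset.

Definition edges_of n (K : {set token n}) : {fset {fset nat}} :=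
  [fset cluster K y | y in [set y in K | 0 < y.1.2]]%fset.

Section Tokens.
Variables (V : finType) (H : hypergraph V) (a : nat) (N : network H a) (n : nat).
(** Here [n] bounds identifiers and port numbers rather than counting vertices; within these bounds
    [inord] loses nothing. *)
Hypothesis ident_le : forall v, ident N v <= n.
Hypothesis ports_le : forall v, size (ports N v) <= n.
Local Notation id := (ident N).
Local Notation toks v := (own_tokens n (id v) (local_view N v)).

Definition announce v : token n := (inord (id v), ord0, inord (id v)).

Lemma announce_inj : injective announce.
Proof.
move=> u v [] /(congr1 val); rewrite /= !inordK ?ltnS ?ident_le // => + _.
exact: ident_inj.
Qed.

Lemma announce_in v : announce v \in toks v.
Proof. by rewrite inE /= inordK ?ltnS ?ident_le // !eqxx. Qed.

Lemma mem_name_ident (S : {set V}) w : (id w \in name_set id S) = (w \in S).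
Proof. exact/mem_name_inj/ident_inj. Qed.

Lemma nth_view v j : nth fset0 (local_view N v) j =
  if j < size (ports N v) then name_set id (nth set0 (ports N v) j) else fset0.
Proof.
case: ltnP => lt_j; first by rewrite (nth_map set0).
by rewrite nth_default // size_map.
Qed.

Lemma mem_tokens v (y : token n) j : (y.1.2 : nat) = j.+1 ->
  reflect [/\ y.1.1 = id v :> nat, j < size (ports N v),
    exists2 w, w \in nth set0 (ports N v) j & y.2 = id w :> nat &
    forall u, u \in nth set0 (ports N v) j -> id v <= id u] (y \in toks v).
Proof.
move=> yj; rewrite inE yj nth_view; case: ltnP => lt_j; last first.
  by rewrite in_fset0 andbF; constructor=> -[].
apply: (iffP and3P) => [[/eqP y1 /mem_name_set yw /allP le_v]|[y1 _ yw le_v]]; split=> //.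
- by move=> u ug; apply: le_v; rewrite mem_name_ident.
- exact/eqP.
- exact/mem_name_set.
- by apply/allP => _ /mem_name_set[w wg ->]; apply: le_v.
Qed.

Variable heard : rel V.
Local Notation K v := (\bigcup_(u | connect heard v u) toks u).

(** Identifiers are distinct, so every token with first coordinate [id u] comes from [u]. Having
    emitted one token for port [j], [u] is least in that edge and has emitted one for each
    member. *)
Lemma cluster_name v u (y : token n) j : connect heard v u -> (y.1.2 : nat) = j.+1 ->
  y \in toks u -> cluster (K v) y = name_set id (nth set0 (ports N u) j).
Proof.
move=> cvu yj yu; have [y1 lt_j _ le_u] := mem_tokens _ yj yu.
apply/fsetP => x; apply/imfsetP/mem_name_set => [[z /=]|[w wg ->]].
  rewrite inE => /andP[/bigcupP[u' cvu' zu'] /eqP zy] ->.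
  have zj : z.1.2 = j.+1 :> nat by rewrite zy.
  have [z1 _ [w wg zw] _] := mem_tokens _ zj zu'.
  exists w => //; suff -> : u = u' by [].
  by apply: (@ident_inj _ _ _ N); rewrite -z1 zy y1.
exists (y.1, inord (id w)); last by rewrite /= inordK // ltnS ident_le.
rewrite inE eqxx andbT; apply/bigcupP; exists u => //.
apply/(mem_tokens _ (j := j)) => //; split=> //.
by exists w => //=; rewrite inordK // ltnS ident_le.
Qed.

Lemma edges_of_sound v f : f \in edges_of (K v) ->
  exists2 g, g \in edges H & f = name_set id g.
Proof.
case/imfsetP => y /=; rewrite inE => /andP[/bigcupP[u cvu yu]].
case yj: (y.1.2 : nat) => [//|j] _ ->.
exists (nth set0 (ports N u) j); last exact: cluster_name.
have [_ lt_j _ _] := mem_tokens _ yj yu.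
by have := mem_nth set0 lt_j; rewrite ports_incident => /andP[].
Qed.

Hypothesis heardP : forall v u g,
  g \in edges H -> v \in g -> u \in g -> v != u -> heard v u.

Lemma connect_edge v u g :
  g \in edges H -> v \in g -> u \in g -> connect heard v u.
Proof.
move=> gE vg ug; have [-> //|nvu] := eqVneq v u.
exact: connect1 (heardP gE vg ug nvu).
Qed.

(** The announcer of [g] is its member [m] of least identifier, which lies in the component because
    it shares [g] with [u]. *)
Lemma edges_of_complete v u g : connect heard v u ->
  g \in edges H -> u \in g -> name_set id g \in edges_of (K v).
Proof.
move=> cvu gE ug; case: (arg_minnP id ug) => m mg min_m.
have cvm := connect_trans cvu (connect_edge gE ug mg).
have gm : g \in ports N m by rewrite ports_incident gE.
have lt_j : index g (ports N m) < size (ports N m) by rewrite index_mem.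
pose y : token n := (inord (id m), inord (index g (ports N m)).+1, inord (id m)).
have yj : y.1.2 = (index g (ports N m)).+1 :> nat.
  by rewrite /= inordK // ltnS (leq_trans lt_j).
have ym : y \in toks m.
  apply/(mem_tokens _ yj); rewrite nth_index //; split=> //=.
  - by rewrite inordK // ltnS ident_le.
  - by exists m; rewrite ?inordK // ltnS ident_le.
apply/imfsetP; exists y => /=; last by rewrite (cluster_name cvm yj ym) nth_index.
by rewrite inE yj andbT; apply/bigcupP; exists m.
Qed.

(** Each vertex announces itself once, and any other token is determined by an incidence, since the
    edge determines its announcer. *)
Lemma card_tokens : #|\bigcup_u toks u| <= #|V| + \sum_(g in edges H) #|g|.
Proof.
pose D := [set d : {set V} * V | (d.1 \in edges H) && (d.2 \in d.1)].
(* The default [d.2] is never taken on [D], where [d.1] is nonempty and has a least member. *)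
pose enc (d : {set V} * V) : token n :=
  let m := odflt d.2 [pick m in d.1 | [forall x in d.1, id m <= id x]] in
  (inord (id m), inord (index d.1 (ports N m)).+1, inord (id d.2)).
have cardD : #|D| = \sum_(g in edges H) #|g|.
  rewrite -sum1_card; under [RHS]eq_bigr do rewrite -sum1_card.
  by rewrite pair_big_dep /=; apply: eq_bigl => d; rewrite inE.
have sub : \bigcup_u toks u \subset (announce @: [set: V]) :|: (enc @: D).
  apply/bigcupsP => u _; apply/subsetP => y yu; rewrite inE; apply/orP.
  case yj: (y.1.2 : nat) => [|j]; [left|right].
    apply/imsetP; exists u => //.
    move: yu; rewrite inE yj => /andP[/eqP y1 /eqP y2].
    case: y yj y1 y2 => [[y1 y2] y3] /= yj u1 u3.
    by congr (_, _, _); apply: val_inj; rewrite /= ?inordK ?ltnS ?ident_le.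
  have [y1 lt_j [w wg yw] le_u] := mem_tokens _ yj yu.
  set g := nth set0 (ports N u) j in wg le_u.
  have : g \in ports N u by apply: mem_nth.
  rewrite ports_incident => /andP[gE ug].
  apply/imsetP; exists (g, w); first by rewrite inE gE.
  rewrite /enc /=; case: pickP => [m /andP[mg /forall_inP le_m]|/(_ u)]; last first.
    by rewrite ug => /negP[]; apply/forall_inP.
  have -> /= : m = u by apply: (@ident_inj _ _ _ N); apply/eqP; rewrite eqn_leq le_m ?le_u.
  rewrite index_uniq ?ports_uniq //.
  case: y yj y1 yw {yu} => [[y1 y2] y3] /= yj u1 u3.
  congr (_, _, _); apply: val_inj; rewrite /= ?inordK ?ltnS ?ident_le //.
  exact: leq_trans lt_j (ports_le u).
apply: leq_trans (subset_leq_card sub) _; apply: leq_trans (leq_card_setU _ _) _.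
rewrite -cardD -cardsT leq_add //; exact: leq_imset_card.
Qed.

(** Together with sparsity, this keeps port numbers in O(n). *)
Lemma size_ports v : size (ports N v) <= \sum_(g in edges H) #|g|.
Proof.
apply: (@leq_trans #|edges H|).
  rewrite cardE; apply: uniq_leq_size; first exact: ports_uniq.
  by move=> g; rewrite mem_enum ports_incident => /andP[].
rewrite -sum1_card; apply: leq_sum => g gE; rewrite card_gt0.
by apply: contraTneq gE => ->; apply: edges_nonempty.
Qed.
End Tokens.

(** * The two models *)

(** The common interface of the two models. The sources to poll are computed from initial knowledge
    alone, and must reach every other vertex sharing an edge. *)
Definition broadcasting (M : model)
    (listen : nat -> seq {fset nat} -> seq (src M)) : Prop :=
  forall (V : finType) (H : hypergraph V) (a : nat) (N : network H a),
  exists heard : V -> src M -> option V,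
    (forall (Msg : Type) (o : V -> addr M -> option Msg) m,
       (forall u x, o u x = m u) ->
       forall v s, deliver N o v s = obind m (heard v s)) /\
    (forall v u g, g \in edges H -> v \in g -> u \in g -> v != u ->
       hears listen N heard v u).

Definition listen_EB (i : nat) (L : seq {fset nat}) : seq (nat * nat) :=
  [seq (j, x) | j <- iota 0 (size L), x <- enum_fset (nth fset0 L j)].

Lemma broadcasting_EB : @broadcasting EB listen_EB.
Proof.
move=> V H a N.
exists (fun v s => [pick u in nth set0 (ports N v) s.1 | ident N u == s.2]).
split=> [Msg o m oE v s|v u g gE vg ug _].
  by rewrite /= /EB_deliver; case: pickP => [u _|_] /=.
have gv : g \in ports N v by rewrite ports_incident gE.
apply/hasP; exists (index g (ports N v), ident N u).
  apply/allpairsPdep; exists (index g (ports N v)), (ident N u).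
  have lt_j : index g (ports N v) < size (ports N v) by rewrite index_mem.
  by rewrite mem_iota size_map /= (nth_map set0) // nth_index // mem_name_ident.
rewrite /= nth_index //; case: pickP => [w /andP[_ /eqP/ident_inj -> //]|/(_ u)].
by rewrite ug eqxx.
Qed.

(** Repetitions and the identifier of the vertex itself are harmless, as only the existence of a
    suitable source is tested. *)
Definition listen_PC (i : nat) (L : seq {fset nat}) : seq nat :=
  flatten [seq enum_fset f | f <- L].

Lemma broadcasting_PC : @broadcasting PC listen_PC.
Proof.
move=> V H a N.
exists (fun v x => [pick u | adjacent H u v && (ident N u == x)]).
split=> [Msg o m oE v s|v u g gE vg ug nvu].
  by rewrite /= /PC_deliver; case: pickP => [u _|_] /=.
apply/hasP; exists (ident N u).
  apply/flattenP; exists (enum_fset (name_set (ident N) g)); last by rewrite mem_name_ident.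
  by apply/map_f/map_f; rewrite ports_incident gE.
case: pickP => [w /andP[_ /eqP/ident_inj -> //]|/(_ u)].
rewrite /adjacent eqxx eq_sym nvu andbT /= => /negbT/negP[]; apply/exists_inP.
by exists g => //; rewrite ug.
Qed.

(** * Locally recognizable problems *)

(* The solutions can be shared out so that a vertex recognizes its own from the
   names of the edges meeting an edge at that vertex. *)
Definition local (P : problem)
    (valid : nat -> {fset {fset nat}} -> named P -> Prop) : Prop :=
  forall (V : finType) (H : hypergraph V) (id : V -> nat), injective id ->
  exists X : V -> {set object P V},
    [/\ forall u v, u != v -> [disjoint X u & X v],
        \bigcup_v X v = solutions P H &
        forall v (E : {fset {fset nat}}),
          (forall f, f \in E -> exists2 g, g \in edges H & f = name_set id g) ->
          (forall g h u, g \in edges H -> h \in edges H ->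
             v \in g -> u \in g -> u \in h -> name_set id h \in E) ->
          forall T, T \in [fset name id x | x in X v]%fset <-> valid (id v) E T].

(** * Sharing out solutions by least identifier *)

Section Ownership.
Variables (V O : finType) (id : V -> nat) (sol : {set O}) (supp : O -> {set V}).
Hypothesis id_inj : injective id.
Hypothesis supp_neq0 : forall T, T \in sol -> supp T != set0.

Definition owned v :=
  [set T in sol | (v \in supp T) && [forall u in supp T, id v <= id u]].

Lemma ownedP v T : reflect
  [/\ T \in sol, v \in supp T & forall u, u \in supp T -> id v <= id u]
  (T \in owned v).
Proof.
by rewrite inE; apply: (iffP and3P) => -[? ? /forall_inP].
Qed.

Lemma owned_disjoint u v : u != v -> [disjoint owned u & owned v].
Proof.
move=> nuv; rewrite -setI_eq0; apply/eqP/setP => T; rewrite in_set0 in_setI.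
apply/negP => /andP[/ownedP[_ uT le_u] /ownedP[_ vT le_v]].
by case/eqP: nuv; apply/id_inj/eqP; rewrite eqn_leq le_u ?le_v.
Qed.

Lemma owned_cover : \bigcup_v owned v = sol.
Proof.
apply/setP => T; apply/bigcupP/idP => [[v _ /ownedP[]//]|Tsol].
have /set0Pn[v0 v0T] := supp_neq0 Tsol.
case: (arg_minnP id v0T) => v vT min_v.
by exists v => //; apply/ownedP; split.
Qed.
End Ownership.

(** * Simplices *)

Definition valid_simplex r (i : nat) (E : {fset {fset nat}}) (S : {fset nat}) :=
  [/\ #|` S| = r.+1, forall F : {fset nat}, (F `<=` S)%fset -> #|` F| = r -> F \in E,
      i \in S & forall x, x \in S -> i <= x].

(** Every facet meets an edge at the owner [v]: as [2 <= r], it has a member [w] other than [v], and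
    the simplex has a third vertex [z]; the facet opposite to [z] contains both [v] and [w]. *)
Lemma local_simplex r : 2 <= r -> @local (simplex_problem r) (valid_simplex r).
Proof.
move=> r_ge2 V H id id_inj.
exists (owned id (simplices r H) (fun S => S)); split.
- exact: owned_disjoint.
- by apply: owned_cover => T; rewrite inE -card_gt0 => /andP[/eqP->].
move=> v E soundE completeE S; split.
  case/imfsetP => T /= /ownedP[]; rewrite inE => /andP[/eqP cardT /forallP facetT] vT le_v ->.
  split.
  - by rewrite card_name_set.
  - move=> F /name_set_preim[G GT ->]; rewrite card_name_set // => cardG.
    have GE : G \in edges H by have := facetT G; rewrite GT cardG eqxx.
    have [w wG] : exists w, w \in G :\ v.
      by apply/set0Pn; rewrite -card_gt0; have := cardsD1 v G; lia.
    move: wG; rewrite !inE => /andP[nwv wG].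
    have wT := subsetP GT w wG.
    have [z] : exists z, z \in T :\: [set v; w].
      apply/set0Pn; rewrite -card_gt0 cardsD cardT.
      have := subset_leq_card (subsetIr T [set v; w]); rewrite cards2; lia.
    rewrite !inE negb_or => /andP[/andP[nzv nzw] zT].
    have TzE : T :\ z \in edges H.
      have cardTz : #|T :\ z| = r by have := cardsD1 z T; rewrite zT; lia.
      by have := facetT (T :\ z); rewrite subsetDl cardTz eqxx.
    apply: (completeE (T :\ z) G w) => //; rewrite !inE.
    + by rewrite eq_sym nzv.
    + by rewrite eq_sym nzw.
  - by rewrite mem_name_inj.
  - by move=> _ /imfsetP[w /= wT ->]; apply: le_v.
case=> cardS facetS vS le_v.
(* So far [S] is a set of numbers. Each lies in an [r]-element subset, which names an edge, so each
   is an identifier. *)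
have [T _ ST] : exists2 T : {set V}, T \subset [set: V] & S = name_set id T.
  apply: name_set_preim; apply/fsubsetP => x xS.
  have [F [FS cardF xF]] : exists F : {fset nat}, [/\ (F `<=` S)%fset, #|` F| = r & x \in F].
    have [z] : exists z, z \in (S `\ x)%fset.
      apply/fset0Pn; rewrite -cardfs_gt0; have := cardfsD1 x S; rewrite xS; lia.
    rewrite !inE => /andP[nzx zS]; exists (S `\ z)%fset; split.
    - exact: fsubD1set.
    - by have := cardfsD1 z S; rewrite zS; lia.
    - by rewrite !inE eq_sym nzx.
  have [g _ Fg] := soundE _ (facetS _ FS cardF).
  by move: xF; rewrite Fg => /imfsetP[w _ ->]; apply/imfsetP; exists w; rewrite ?inE.
apply/imfsetP; exists T => //=; rewrite {}ST in cardS facetS vS le_v *.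
rewrite mem_name_inj // in vS; rewrite card_name_set // in cardS.
apply/ownedP; split=> //; last by move=> u uT; apply: le_v; rewrite mem_name_inj.
rewrite inE cardS eqxx /=; apply/forallP => F; apply/implyP => /andP[FT /eqP cardF].
have subF : (name_set id F `<=` name_set id T)%fset.
  by apply/fsubsetP => _ /imfsetP[w /= wF ->]; rewrite mem_name_inj // (subsetP FT).
have [|g gE /(name_set_inj id_inj) -> //] := soundE _ (facetS _ subF _).
by rewrite card_name_set.
Qed.

(** * Triangles *)

Definition valid_triangle (induced : bool) (i : nat) (E : {fset {fset nat}})
    (T : {fset nat * {fset nat}}) :=
  exists (x : 'I_3 -> nat) (f : 'I_3 -> {fset nat}),
    [/\ injective x /\ injective f,
        forall j, [/\ f j \in E, x j \in f (j - 1)%R & x j \in f j],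
        induced -> forall j, x j \notin f (j + 1)%R,
        forall p, p \in T <-> exists j, p = (x j, f j) \/ p = (x j, f (j - 1)%R) &
        (exists j, x j = i) /\ forall j, i <= x j].

Definition triangles_of (induced : bool) (V : finType) (H : hypergraph V) :=
  [set incidences t.1 t.2
     | t : {ffun 'I_3 -> V} * {ffun 'I_3 -> {set V}}
     & triangle_seq H t.1 t.2 && (induced ==> induced_seq t.1 t.2)].

Lemma mem_incidences (V : finType) (v : {ffun 'I_3 -> V}) (e : {ffun 'I_3 -> {set V}}) p :
  reflect (exists j, p = (v j, e j) \/ p = (v j, e (j - 1)%R))
          (p \in incidences v e).
Proof.
rewrite inE; apply: (iffP orP) => [[] /imsetP[j _ ->]|[j [->|->]]].
- by exists j; left.
- by exists j; right.
- by left; apply: imset_f.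
- by right; apply: imset_f.
Qed.

Lemma triangles_ofP (induced : bool) (V : finType) (H : hypergraph V) T :
  reflect (exists (v : {ffun 'I_3 -> V}) (e : {ffun 'I_3 -> {set V}}),
    [/\ injective v /\ injective e,
        forall j, [/\ e j \in edges H, v j \in e (j - 1)%R & v j \in e j],
        induced -> forall j, v j \notin e (j + 1)%R & T = incidences v e])
  (T \in triangles_of induced H).
Proof.
apply: (iffP imsetP) => [[[v e]]|[v [e [[iv ie] ve ind ->]]]].
  rewrite inE => /andP[/and4P[/injectiveP iv /injectiveP ie /forallP eE /forallP ve] ind] /= ->.
  exists v, e; split=> // [j|/(implyP ind)/forallP //].
  by have := ve j; rewrite inE => /andP[].
exists (v, e) => //; rewrite inE /=; apply/andP; split.
  apply/and4P; split; [exact/injectiveP|exact/injectiveP| |];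
    by apply/forallP => j; have [? ? ?] := ve j; rewrite ?inE; try apply/andP.
by apply/implyP => /ind ?; apply/forallP.
Qed.

Lemma ord3_cases (j k : 'I_3) : j = k \/ j = (k + 1)%R \/ j = (k - 1)%R.
Proof.
by case: j k => [[|[|[|?]]] ?] [[|[|[|?]]] ?] //;
  first [left; exact: val_inj | right; left; exact: val_inj
        | right; right; exact: val_inj].
Qed.

(** If [v j0] is the owner, the edges of index [j0] and [j0 - 1] contain it, and the third one meets
    [e j0] at [v (j0 + 1)]. *)
Lemma local_triangle (induced : bool) :
  @local (@Problem (fun V => {set V * {set V}} : finType) _ name_triangle
            (triangles_of induced)) (valid_triangle induced).
Proof.
move=> V H id id_inj.
have supp_inc (v : {ffun 'I_3 -> V}) (e : {ffun 'I_3 -> {set V}}) w :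
    reflect (exists j, w = v j) (w \in [set p.1 | p in incidences v e]).
  apply: (iffP imsetP) => [[p /mem_incidences[j [->|->]] ->]|[j ->]]; try by exists j.
  by exists (v j, e j) => //; apply/mem_incidences; exists j; left.
exists (owned id (triangles_of induced H) (fun T => [set p.1 | p in T])); split.
- exact: owned_disjoint.
- apply: owned_cover => T /triangles_ofP[v [e [_ _ _ ->]]].
  by apply/set0Pn; exists (v ord0); apply/supp_inc; exists ord0.
move=> w E soundE completeE T; split.
  case/imfsetP => S /= /ownedP[/triangles_ofP[v [e [[iv ie] ve ind ->]]]].
  case/supp_inc => j0 w_j0 le_w ->.
  exists (fun j => id (v j)), (fun j => name_set id (e j)); split.
  - by split=> j k; [move/id_inj/iv | move/(name_set_inj id_inj)/ie].
  - move=> j; have [eE v1 v0] := ve j; rewrite !mem_name_inj //; split=> //.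
    have [eE0 v01 v00] := ve j0.
    case: (ord3_cases j j0) eE v1 => [->|[->|->]] eE v1.
    + by apply: (completeE (e j0) (e j0) (v j0)) => //; rewrite w_j0.
    + apply: (completeE (e j0) _ (v (j0 + 1)%R)) => //; first by rewrite w_j0.
        by rewrite GRing.addrK in v1.
      by have [] := ve (j0 + 1)%R.
    + by apply: (completeE (e j0) _ (v j0)) => //; rewrite w_j0.
  - by move=> /ind + j => /(_ j); rewrite mem_name_inj.
  - move=> p; split.
      case/imfsetP => q /= /mem_incidences[j [->|->]] -> /=; exists j; [by left|by right].
    case=> j [->|->]; apply/imfsetP.
      by exists (v j, e j) => //=; apply/mem_incidences; exists j; left.
    by exists (v j, e (j - 1)%R) => //=; apply/mem_incidences; exists j; right.
  - split; first by exists j0; rewrite w_j0.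
    by move=> j; apply: le_w; apply/supp_inc; exists j.
case=> x [f [[ix jf] xf ind memT [[j0 xj0] le_w]]].
(* Finite choice recovers the edges, and then the vertices, from their names. *)
have [g gP] : exists g : 'I_3 -> {set V}, forall j, g j \in edges H /\ f j = name_set id (g j).
  apply: (@fin_all_exists _ _ (fun j g => g \in edges H /\ f j = name_set id g)) => j.
  by have [/soundE[g gE fg] _ _] := xf j; exists g.
have [v vP] : exists v : 'I_3 -> V, forall j, x j = id (v j).
  apply: (@fin_all_exists _ _ (fun j v => x j = id v)) => j.
  have [_ _] := xf j; have [_ ->] := gP j.
  by case/imfsetP => u _ ->; exists u.
have mem_vg j k : (v j \in g k) = (x j \in f k).
  by have [_ ->] := gP k; rewrite vP mem_name_inj.
pose vv := [ffun j => v j]; pose ee := [ffun j => g j].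
apply/imfsetP; exists (incidences vv ee) => /=.
  apply/ownedP; split.
  - apply/triangles_ofP; exists vv, ee; split=> //.
    + split=> j k; rewrite !ffunE => jk.
        by apply: ix; rewrite !vP jk.
      by apply: jf; have [_ ->] := gP j; have [_ ->] := gP k; rewrite jk.
    + move=> j; rewrite !ffunE !mem_vg; have [? ? ?] := xf j; by split=> //; have [] := gP j.
    + by move=> /ind + j => /(_ j); rewrite !ffunE mem_vg.
  - apply/supp_inc; exists j0; rewrite ffunE; apply: id_inj; by rewrite -vP.
  - by move=> u /supp_inc[j ->]; rewrite ffunE -vP.
apply/fsetP => p; apply/idP/imfsetP => [/memT[j pj]|[q /= /mem_incidences[j qj] ->]].
  case: pj => ->.
    exists (vv j, ee j) => /=; first by apply/mem_incidences; exists j; left.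
    by rewrite !ffunE -vP; have [_ ->] := gP j.
  exists (vv j, ee (j - 1)%R) => /=; first by apply/mem_incidences; exists j; right.
  by rewrite !ffunE -vP; have [_ ->] := gP (j - 1)%R.
apply/memT; exists j; case: qj => ->; rewrite /= !ffunE -vP; [left|right].
- by have [_ ->] := gP j.
- by have [_ ->] := gP (j - 1)%R.
Qed.

Lemma local_triangle_problem : @local triangle_problem (valid_triangle false).
Proof.
move=> V H id id_inj; have [X [dis cov mem]] := @local_triangle false V H id id_inj.
exists X; split=> //; rewrite cov; apply/setP => T.
by apply/imsetP/imsetP => -[t tH ->]; exists t => //; move: tH; rewrite !inE andbT.
Qed.

Lemma local_induced_triangle_problem :
  @local induced_triangle_problem (valid_triangle true).
Proof.
move=> V H id id_inj; have [X [dis cov mem]] := @local_triangle true V H id id_inj.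
by exists X.
Qed.

(** * Running time *)

Lemma leq_lg n : n < 2 ^ lg n.
Proof. exact: up_logP. Qed.

(** At most [(C + 1) * #|V|] tokens require at most [(2 * C + 3) * #|V|] phases. A phase takes
    [3 * L.+1] rounds, [L.+1] for each coordinate of a token. *)
Lemma local_enumerable (M : model) (P : problem) listen valid B a C c :
  @broadcasting M listen -> @local P valid ->
  (forall n, 0 < n -> lg n <= c * B n) ->
  sparse_enumerable M P B a C (3 * (c * (a + C + 1)).+1 * (2 * C + 3)).
Proof.
move=> bcast loc leB; set L := c * (a + C + 1).
(* The token range must be computable from [b], since a vertex ignores [#|V|]. *)
pose size_of b := 2 ^ (L * b).
(* Local computation is unbounded, so the output is specified by choice; locality supplies a set
   meeting the specification. *)
pose result n i (K : {set token n}) : {fset named P} :=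
  epsilon (inhabits fset0) (fun S => forall T, T \in S <-> valid i (edges_of K) T).
exists (fun b => chunked b (3 * L.+1).-1
  (@gossip_init M _ (own_tokens (size_of b)) listen)
  (@gossip_message M _) (@gossip_update M _)
  (gossip_answer (result (size_of b)))).
move=> V H N spH; have [X [disj cov memX]] := loc V H _ (@ident_inj _ _ _ N).
exists X; split=> // v.
have V_gt0 : 0 < #|V| by apply/card_gt0P; exists v.
have lgV := leB _ V_gt0; set b := B #|V| in lgV *; set n := size_of b.
have lg_gt0 : 0 < lg #|V|.
  by have := leq_lg #|V|; case: (lg _) => //; rewrite expn0; lia.
have b_gt0 : 0 < b by rewrite lt0n; apply: contraTneq lgV => ->; rewrite muln0 -ltnNge.
(* The exponent is at most [(a + C + 1) * (c * b)], that is [L * b]: [a] pays for identifiers and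
   [C.+1] for port numbers. *)
have pow_le k : k <= a + C + 1 -> 2 ^ (k * lg #|V|) <= n.
  by move=> le_k; rewrite leq_exp2l // /L; nia.
have id_le u : ident N u <= n.
  apply: ltnW; apply: leq_trans (ident_bits N u) (pow_le a _); lia.
have CV_le : C * #|V| <= n.
  apply: leq_trans (pow_le C.+1 _); last lia.
  rewrite mulSn expnD mulnC leq_mul ?(ltnW (leq_lg _)) //.
  apply: leq_trans (ltnW (ltn_expl C (ltnSn 1))) _.
  by rewrite leq_exp2l // leq_pmulr.
have ports_le u : size (ports N u) <= n.
  by apply: leq_trans (size_ports N u) _; apply: leq_trans spH CV_le.
have [heard [deliverE heardP]] := bcast V H a N.
have leY : #|{: token n}| <= 2 ^ (b * (3 * L.+1).-1.+1).
  rewrite /token !card_prod !card_ord prednK ?muln_gt0 //.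
  (* The additional [b] bits absorb the successor. *)
  have le_n : n.+1 <= 2 ^ (b * L.+1).
    rewrite mulnS expnD; have : 2 <= 2 ^ b by rewrite -{1}(expn1 2) leq_exp2l.
    have : 0 < n by rewrite expn_gt0.
    have -> : 2 ^ (b * L) = n by rewrite mulnC.
    nia.
  by rewrite mulnCA [3 * _]mulnC expnM !expnS expn0 muln1 mulnA !leq_mul.
have -> : 3 * L.+1 * (2 * C + 3) * #|V| = (2 * C + 3) * #|V| * (3 * L.+1).-1.+1.
  by rewrite prednK ?muln_gt0 //; lia.
rewrite (run_chunked _ _ _ _ leY deliverE) /=.
have announceP := announce_in id_le.
rewrite (coarse_answer (initial_tokens := own_tokens n) _ _ _
  (announce_inj id_le) announceP); last first.
  have le_tok := card_tokens id_le ports_le.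
  (* Strictness uses the spare [#|V|], which is positive. *)
  have /(leq_ltn_trans (leq_mul (leqnn 2) le_tok)) : 2 * (#|V| + \sum_(g in edges H) #|g|)
      < (2 * C + 3) * #|V|.
    by move: spH V_gt0; rewrite /sparse; set s := \sum_(g in _) _; nia.
  by [].
congr Some; apply/fsetP => T.
set K := \bigcup_(u | connect _ v u) _.
have {}memX : forall T, T \in [fset name (ident N) x | x in X v]%fset <->
    valid (ident N v) (edges_of K) T.
  apply: memX => [f|g h u gE hE vg ug uh]; first exact: edges_of_sound.
  apply: (edges_of_complete id_le ports_le heardP) uh => //.
  exact: (connect_edge heardP gE).
have chosen := epsilon_spec (inhabits fset0)
  (fun S : {fset named P} => forall T, T \in S <-> valid (ident N v) (edges_of K) T)
  (ex_intro _ _ memX).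
apply/idP/idP => [/chosen/memX|/memX/chosen] //.
Qed.

Theorem corollary38 (B : nat -> nat) (a C : nat) (hB : theta_log B) :
  exists K : nat, forall M : model, M = EB \/ M = PC ->
    [/\ sparse_enumerable M triangle_problem B a C K,
        sparse_enumerable M induced_triangle_problem B a C K &
        forall r : nat, 2 <= r ->
          sparse_enumerable M (simplex_problem r) B a C K].
Proof.
case: hB => c cB; have leB n : 0 < n -> lg n <= c * B n by case/cB.
exists (3 * (c * (a + C + 1)).+1 * (2 * C + 3)) => M modelM.
have [listen bcast] : exists listen, @broadcasting M listen.
  case: modelM => ->; [exists listen_EB|exists listen_PC].
    exact: broadcasting_EB.
  exact: broadcasting_PC.
split=> [||r r_ge2].
- exact: local_enumerable bcast local_triangle_problem leB.
- exact: local_enumerable bcast local_induced_triangle_problem leB.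
- exact: local_enumerable bcast (local_simplex r_ge2) leB.
Qed.
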